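(* The 1-Disjoint Single Alternative Path problem (1D-SAP, defined in the context) with a Pareto-conform psychological model and cost functions with Pareto dimension $k$ whose derivatives have Pareto dimension $\ell$ reduces to solving a multi-criteria shortest path problem with $k+\ell$ criteria and scoring the result. That is, there is a directed graph $G'$ of size linear in that of $G$, with designated vertices $s,t$ and edge weights in $\mathbb{Q}^{k+\ell}$, whose $s$–$t$ paths correspond to the 1-disjoint alternatives in $G$ with the same cost functions, such that the set of $s$–$t$ paths of $G'$ whose total weight is not Pareto dominated by that of another $s$–$t$ path of $G'$ contains (the counterpart of) an optimal solution of 1D-SAP.
   Context: Setting (SAP). Let $G=(V,E)$ be a directed graph, $s,t\in V$, and $d>0$ a rational demand. Every edge $e$ has a cost function $\tau_e:\mathbb{Q}_{\ge 0}\to\mathbb{Q}_{>0}$, monotonically increasing and differentiable; functions are considered on $[0,d]$ and inequalities between functions are pointwise on $[0,d]$. Paths are identified with edge sets; $\tau_A=\sum_{e\in A}\tau_e$ (zero if $A=\emptyset$), $\tau'_A$ its derivative. An original simple $s$–$t$ path $Q$ is fixed. An alternative is a simple $s$–$t$ path $P$; $\mathcal{C}_P(x)=x\,\tau_{P\setminus Q}(x)+(d-x)\,\tau_{Q\setminus P}(d-x)+d\,\tau_{P\cap Q}(d)$. A psychological model assigns to every alternative $P$ a value $x_P\in[0,d]$, and $\mathcal{C}_P:=\mathcal{C}_P(x_P)$. 1D-SAP asks for an alternative $P$ minimizing $\mathcal{C}_P$ among the 1-disjoint ones, i.e., those for which $P\setminus Q$ forms a single connected path ($P$ diverts from $Q$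 at most once). Dominance: $P_1\preceq P_2$ iff $\tau_{P_1}\le\tau_{P_2}$ and $\tau'_{P_1\cap Q}\le\tau'_{P_2\cap Q}$. The model is Pareto-conform if $P_1\preceq P_2$ implies $\mathcal{C}_{P_1}\le\mathcal{C}_{P_2}$. Standing assumption: no two different paths dominate each other mutually. A class $\mathcal{T}$ of functions on $[0,d]$ closed under addition has Pareto dimension $k$ if there is $p:\mathcal{T}\to\mathbb{Q}^k$ with $\tau_1\le\tau_2$ iff $p(\tau_1)\le p(\tau_2)$ componentwise and $p(\tau_1+\tau_2)=p(\tau_1)+p(\tau_2)$. ''Cost functions with Pareto dimension $k$ whose derivatives have Pareto dimension $\ell$'': all $\tau_e$ lie in such a class with representation $p$, and the derivatives of that class form a class of Pareto dimension $\ell$. A multi-criteria shortest path problem with $m$ criteria: given edge weights in $\mathbb{Q}^m$ (path weight = sum), compute all $s$–$t$ paths whose weight is not Pareto dominated (componentwise $\le$ and different) by the weight of another $s$–$t$ path. Scoring a set of alternatives means computing $\mathcal{C}_P$ for each and choosing the best.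
   Formalization: Paths of G' are not in full bijection with 1-disjoint alternatives (impossible in linear size): each alternative has exactly one counterpart, each s–t path of G' only contains an alternative (equal to it if its image is simple), and all Pareto-optimal paths are alternatives. *)

(* Defs.v *)
From mathcomp Require Import all_boot all_order all_algebra.
From mathcomp Require Import all_classical all_reals all_analysis.
Import Order.TTheory GRing.Theory Num.Theory numFieldNormedType.Exports.

Set Implicit Arguments.
Unset Strict Implicit.
Unset Printing Implicit Defensive.

Local Open Scope ring_scope.

(* Paths are identified with their edge sets.  The edge set of a simple u-v
   path in the digraph with edge set [E]; for [u = v] this is the empty path. *)
Definition simple_path (V : finType) (E : {set V * V}) (u v : V)
    (P : {set V * V}) : Prop :=
  exists q : seq V,
    [/\ path (fun a b => (a, b) \in E) u q, last u q = v, uniq (u :: q)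
      & P = [set e in pairmap pair u q]%SET].

(* [P] leaves [Q] at most once; the empty path is allowed as [P :\: Q], so
   [Q] itself qualifies. *)
Definition one_disjoint (V : finType) (E : {set V * V}) (s t : V)
    (Q P : {set V * V}) : Prop :=
  simple_path E s t P /\ exists u v : V, simple_path E u v (P :\: Q).

(* Derivatives of functions Q -> Q relative to a domain [D] of rationals
   (one-sided at the endpoints of [D]); [^o] provides the usual topology
   of the ordered field Q. *)
Definition diff_quotient (f : rat -> rat) (x y : rat) : rat^o :=
  (f y - f x) / (y - x).

Definition derivable_on (D : set rat) (f : rat -> rat) : Prop :=
  forall x : rat, D x ->
    cvg (diff_quotient f x @ within D (dnbhs (x : rat^o)))%classic.

Definition derive_on (D : set rat) (f : rat -> rat) (x : rat) : rat :=
  lim (diff_quotient f x @ within D (dnbhs (x : rat^o)))%classic.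

Definition demand_itv (d : rat) : set rat := `[0, d]%classic.

Definition le_on (d : rat) (f g : rat -> rat) : Prop :=
  forall x : rat, 0 <= x <= d -> f x <= g x.

Definition cost_function (f : rat -> rat) : Prop :=
  [/\ forall x, 0 <= x -> 0 < f x,
      forall x y, 0 <= x -> x <= y -> f x <= f y
    & derivable_on `[0, +oo[%classic f].

(* Classes of functions on [0, d] are given by representatives rat -> rat; the
   order condition forces [p] to take the same value on representatives that
   agree on [0, d]. *)
Definition pareto_representation (d : rat) (T : set (rat -> rat)) (k : nat)
    (p : (rat -> rat) -> 'rV[rat]_k) : Prop :=
  [/\ forall f g, T f -> T g -> T (fun x => f x + g x),
      forall f g, T f -> T g ->
        (le_on d f g <-> forall i, p f 0 i <= p g 0 i)
    & forall f g, T f -> T g -> p (fun x => f x + g x) = p f + p g].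

(* All representatives of the derivatives on [0, d] of members of [T]. *)
Definition derivative_class (d : rat) (T : set (rat -> rat)) :
    set (rat -> rat) :=
  fun g => exists f : rat -> rat,
    [/\ T f, derivable_on (demand_itv d) f
      & forall x, 0 <= x <= d -> g x = derive_on (demand_itv d) f x].

Definition path_cost (V : finType) (tau : V * V -> rat -> rat)
    (A : {set V * V}) : rat -> rat :=
  fun x => \sum_(e in A) tau e x.

Definition dominates (V : finType) (d : rat) (tau : V * V -> rat -> rat)
    (Q P1 P2 : {set V * V}) : Prop :=
  le_on d (path_cost tau P1) (path_cost tau P2) /\
  le_on d (derive_on (demand_itv d) (path_cost tau (P1 :&: Q)))
          (derive_on (demand_itv d) (path_cost tau (P2 :&: Q))).

(* [x P] is the flow that the psychological model puts on the alternative [P]. *)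
Definition alternative_cost (V : finType) (d : rat) (tau : V * V -> rat -> rat)
    (Q : {set V * V}) (x : {set V * V} -> rat) (P : {set V * V}) : rat :=
  x P * path_cost tau (P :\: Q) (x P)
  + (d - x P) * path_cost tau (Q :\: P) (d - x P)
  + d * path_cost tau (P :&: Q) d.

Definition pareto_conform (V : finType) (E : {set V * V}) (s t : V) (d : rat)
    (tau : V * V -> rat -> rat) (Q : {set V * V})
    (x : {set V * V} -> rat) : Prop :=
  forall P1 P2 : {set V * V}, simple_path E s t P1 -> simple_path E s t P2 ->
    dominates d tau Q P1 P2 ->
    alternative_cost d tau Q x P1 <= alternative_cost d tau Q x P2.

Definition optimal_1D_SAP (V : finType) (E : {set V * V}) (s t : V) (d : rat)
    (tau : V * V -> rat -> rat) (Q : {set V * V})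
    (x : {set V * V} -> rat) (P : {set V * V}) : Prop :=
  one_disjoint E s t Q P /\
  forall P', one_disjoint E s t Q P' ->
    alternative_cost d tau Q x P <= alternative_cost d tau Q x P'.

Definition path_weight (V : finType) (m : nat) (w : V * V -> 'rV[rat]_m)
    (R : {set V * V}) : 'rV[rat]_m :=
  \sum_(e in R) w e.

Definition pareto_optimal_path (V : finType) (E : {set V * V}) (s t : V)
    (m : nat) (w : V * V -> 'rV[rat]_m) (R : {set V * V}) : Prop :=
  simple_path E s t R /\
  ~ exists R', [/\ simple_path E s t R',
                   forall i, path_weight w R' 0 i <= path_weight w R 0 i
                 & path_weight w R' <> path_weight w R].

Definition edge_map (V' V : finType) (pi : V' -> V) (e : V' * V') : V * V :=
  (pi e.1, pi e.2).

(* The edges of the digraph G' = (V', E') are copies of edges of G = (V, E)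
   via [pi] (and thereby inherit their cost functions), and every 1-disjoint
   alternative of G lifts to exactly one s'-t' path of G'.  Conversely, an
   s'-t' path R of G' projects to an s-t walk of G, which may revisit a vertex;
   the edge set pi(R) always contains a 1-disjoint alternative, and is equal to
   it as soon as pi(R) is a simple path, since no simple s-t path is a proper
   subset of another one.  Hence R |-> pi(R) is a bijection from the s'-t'
   paths that project to simple paths onto the 1-disjoint alternatives. *)
Definition represents_one_disjoint (V V' : finType) (E : {set V * V}) (s t : V)
    (Q : {set V * V}) (E' : {set V' * V'}) (s' t' : V') (pi : V' -> V) : Prop :=
  [/\ pi s' = s /\ pi t' = t,
      forall e, e \in E' -> edge_map pi e \in E,
      forall P, one_disjoint E s t Q P ->
        exists! R, simple_path E' s' t' R /\ (edge_map pi @: R)%SET = P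
    & forall R, simple_path E' s' t' R ->
        exists2 P, one_disjoint E s t Q P & P \subset (edge_map pi @: R)%SET].

(* A copy of [e] is weighted by the representations of its cost function and of
   its contribution to the derivative of the cost of [P :&: Q]. *)
Definition copy_weight (V V' : finType) (d : rat) (tau : V * V -> rat -> rat)
    (Q : {set V * V}) (k l : nat) (p : (rat -> rat) -> 'rV[rat]_k)
    (p' : (rat -> rat) -> 'rV[rat]_l) (pi : V' -> V) (e : V' * V') :
    'rV[rat]_(k + l) :=
  row_mx (p (tau (edge_map pi e)))
    (if edge_map pi e \in Q
     then p' (derive_on (demand_itv d) (tau (edge_map pi e))) else 0).

(* Main.v *)
(* A simple s-t path is 1-disjoint from Q iff its edge word has the form
   Q-edges, then non-Q-edges, then Q-edges, i.e. if it switches at most twice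
   between Q and its complement.  G' consists of three copies of V that count
   these switches.  The language of such words is closed under subwords, so
   deleting loops from the projection of an s'-t' path of G' leaves a 1-disjoint
   alternative.  A Pareto representation is additive and nonnegative (positive
   somewhere on positive functions), hence deleting edges strictly decreases the
   weight and Pareto optimal paths of G' project to 1-disjoint alternatives;
   moreover weight domination implies domination of alternatives.  Among the
   optimal alternatives, one of least total weight therefore lifts to a Pareto
   optimal path. *)
Require Import Defs.
From mathcomp Require Import all_boot all_order all_algebra.
From mathcomp Require Import all_classical all_reals all_analysis.
Import Order.TTheory GRing.Theory Num.Theory numFieldNormedType.Exports.
Local Open Scope ring_scope.

Set Implicit Arguments.
Unset Strict Implicit.
Unset Printing Implicit Defensive.

(** * Walks and their edges *)

Section Walks.
Variable V : eqType.
Implicit Types (u v a b : V) (q r : seq V).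

Lemma pairmap_pair_split u q a b : (a, b) \in pairmap pair u q ->
  exists q1 q2, u :: q = q1 ++ a :: b :: q2.
Proof.
elim: q u => [//|c q IHq] u /=; rewrite inE => /orP[/eqP[-> ->]|/IHq[q1 [q2 E]]].
  by exists [::], q.
by exists (u :: q1), q2; rewrite E.
Qed.

Lemma uniq_split_inj a q1 q2 r1 r2 : uniq (q1 ++ a :: q2) ->
  q1 ++ a :: q2 = r1 ++ a :: r2 -> q1 = r1 /\ q2 = r2.
Proof.
have index_split (l1 l2 : seq V) : uniq (l1 ++ a :: l2) ->
    index a (l1 ++ a :: l2) = size l1.
  rewrite cat_uniq /= negb_or => /and3P[_ /andP[al1 _] _].
  by rewrite index_cat (negPf al1) /= eqxx addn0.
move=> Uq E; have /eqP := E.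
rewrite eqseq_cat; last by rewrite -(index_split _ _ Uq) E index_split // -E.
by move=> /andP[/eqP-> /eqP[->]].
Qed.

(** A vertex of a simple path has at most one outgoing path edge, so a walk along path edges is
    forced at every step. *)
Lemma walk_in_simple_path u q a r : uniq (u :: q) -> a \in u :: q ->
  path (fun x y => (x, y) \in pairmap pair u q) a r ->
  exists q1 q2, u :: q = q1 ++ (a :: r) ++ q2.
Proof.
move=> Uq aq; elim/last_ind: r => [|r y IHr].
  by move=> _; case/splitPr: aq => q1 q2; exists q1, q2.
rewrite rcons_path => /andP[/IHr[q1 [q2 E]] /pairmap_pair_split[r1 [r2 E']]].
have E1 : u :: q = (q1 ++ belast a r) ++ last a r :: q2.
  by rewrite E lastI cat_rcons -catA.
have [_ E2] : q1 ++ belast a r = r1 /\ q2 = y :: r2.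
  by apply: (@uniq_split_inj (last a r)); rewrite -E1 // E'.
by exists q1, r2; rewrite E E2 -rcons_cons cat_rcons.
Qed.

Lemma walk_in_simple_path_eq u q r : uniq (u :: q) ->
  path (fun x y => (x, y) \in pairmap pair u q) u r ->
  last u r = last u q -> r = q.
Proof.
move=> Uq Pr Lr.
(* A nonempty [q1] would make the path visit its start twice, a nonempty [q2] its end. *)
have [[|x q1] [q2 E]] := walk_in_simple_path Uq (mem_head _ _) Pr; last first.
  by case: E Uq => _ -> /=; rewrite mem_cat mem_head orbT.
case: E Lr Uq => ->; case/lastP: q2 => [|q2 y]; first by rewrite cats0.
rewrite last_cat last_rcons => Lr.
by rewrite -cat_cons cat_uniq -Lr has_rcons mem_last andbF.
Qed.

Lemma path_pairmap (A : {pred V * V}) u q :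
  path (fun x y => (x, y) \in A) u q = all (mem A) (pairmap pair u q).
Proof. by elim: q u => //= b q IHq u; rewrite IHq. Qed.

Lemma pairmap_pair_uniq u q : uniq (u :: q) -> uniq (pairmap pair u q).
Proof.
move=> Uq; apply: (@map_uniq _ _ fst).
suff -> : map fst (pairmap pair u q) = belast u q.
  by move: Uq; rewrite lastI rcons_uniq => /andP[].
by elim: q u {Uq} => //= b q IHq u; rewrite IHq.
Qed.

Lemma remove_loops u q : exists r,
  [/\ uniq (u :: r), last u r = last u q
    & subseq (pairmap pair u r) (pairmap pair u q)].
Proof.
elim: q u => [|b q IHq] u; first by exists [::].
have [r [Ur Lr Sr]] := IHq b.
have [ur|ur] := boolP (u \in b :: r); last first.
  by exists (b :: r); rewrite cons_uniq ur Ur /= eqxx.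
case/splitPr E : {1}_ / ur => [[|c l] m].
  case: E Ur Lr Sr => -> -> Ur Lr Sr; exists m; split=> //=.
  exact: subseq_trans Sr (subseq_cons _ _).
case: E Ur Lr Sr => _ -> Ur Lr Sr; exists m; split.
- by move: Ur; rewrite -cat_cons cat_uniq => /and3P[].
- by rewrite /= -Lr last_cat.
- apply: subseq_trans (subseq_trans Sr (subseq_cons _ _)).
  by rewrite pairmap_cat /= -cat_rcons suffix_subseq.
Qed.

End Walks.

(** * The layered graph *)

Section LayeredGraph.
Variables (V : finType) (E Q : {set V * V}) (s t : V).
Implicit Types (u v : V) (q : seq V) (x y : V * 'I_3) (w : seq (V * V)).
Implicit Types (P : {set V * V}).

(* The layer is the number of switches made so far: it is even as long as the
   walk follows Q, and odd off Q. *)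
Definition next_layer (i : nat) (e : V * V) : nat :=
  (i + (odd i == (e \in Q)))%N.

Definition final_layer (i : nat) w : nat := foldl next_layer i w.

Lemma next_layer_ge i e : (i <= next_layer i e)%N.
Proof. exact: leq_addr. Qed.

Lemma final_layer_ge i w : (i <= final_layer i w)%N.
Proof.
elim: w i => //= e w IHw i; exact: leq_trans (next_layer_ge _ _) (IHw _).
Qed.

(** A step raises the counter by at most one, so a counter that is behind can catch up but not
    overtake. *)
Lemma next_layer_mono e i j : (i <= j)%N -> (next_layer i e <= next_layer j e)%N.
Proof.
rewrite leq_eqVlt => /orP[/eqP-> //|ij].
by apply: leq_trans (leq_trans ij (next_layer_ge _ _)); rewrite -addn1 leq_add2l leq_b1.
Qed.

Lemma final_layer_mono w i j : (i <= j)%N -> (final_layer i w <= final_layer j w)%N.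
Proof. by elim: w i j => //= e w IHw i j /(next_layer_mono e)/IHw. Qed.

(** Skipping a letter leaves the counter no higher than reading it, and monotonicity in the starting
    layer carries this to the end. *)
Lemma final_layer_subseq i w1 w2 : subseq w1 w2 ->
  (final_layer i w1 <= final_layer i w2)%N.
Proof.
elim: w2 w1 i => [|e w2 IH] w1 i; first by rewrite subseq0 => /eqP->.
case: w1 => [|e' w1]; first by rewrite /= (leq_trans (next_layer_ge i e)) ?final_layer_ge.
rewrite /=; case: eqP => [->|_] S; first exact: IH.
apply: (leq_trans (IH (e' :: w1) i S)); apply: final_layer_mono; exact: next_layer_ge.
Qed.

Lemma final_layer_even i w : ~~ odd i -> all (mem Q) w -> final_layer i w = i.
Proof.
move=> oi; elim: w => //= e w IHw /andP[eQ /IHw].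
by rewrite /next_layer (negPf oi) eQ addn0.
Qed.

Lemma final_layer_odd i w : odd i -> all (predC (mem Q)) w -> final_layer i w = i.
Proof.
move=> oi; elim: w => //= e w IHw /andP[eQ /IHw].
by rewrite /next_layer oi (negPf eQ) addn0.
Qed.

Lemma final_layer_three w1 w2 w3 : all (mem Q) w1 -> all (predC (mem Q)) w2 ->
  all (mem Q) w3 -> (final_layer 0 (w1 ++ w2 ++ w3) <= 2)%N.
Proof.
move=> Q1 Q2 Q3; rewrite /final_layer !foldl_cat -!/(final_layer _ _).
rewrite (final_layer_even _ Q1) //.
(* Starting the middle block in layer 1, where it stays, bounds its run from layer 0 and covers an
   empty block as well. *)
have := final_layer_mono w2 (leq0n 1); rewrite (@final_layer_odd 1 _ isT Q2) => le1.
apply: leq_trans (final_layer_mono _ (leqW le1)) _.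
by rewrite final_layer_even.
Qed.

(** Read from the top layer down: layer 2 tolerates only edges of [Q], layer 1 lasts until the first
    edge of [Q], layer 0 until the first edge off [Q]. *)
Lemma final_layer_le2 u q : (final_layer 0 (pairmap pair u q) <= 2)%N ->
  exists q1 q2 q3, [/\ q = q1 ++ q2 ++ q3,
    all (mem Q) (pairmap pair u q1),
    all (predC (mem Q)) (pairmap pair (last u q1) q2)
    & all (mem Q) (pairmap pair (last (last u q1) q2) q3)].
Proof.
have suffix v r : (final_layer 2 (pairmap pair v r) <= 2)%N ->
    all (mem Q) (pairmap pair v r).
  elim: r v => //= b r IHr v; rewrite {1}/next_layer /=.
  case: ((v, b) \in Q) => /=; first exact: IHr.
  by move/(leq_trans (final_layer_ge _ _)).
have middle v r : (final_layer 1 (pairmap pair v r) <= 2)%N ->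
    exists r1 r2, [/\ r = r1 ++ r2, all (predC (mem Q)) (pairmap pair v r1)
      & all (mem Q) (pairmap pair (last v r1) r2)].
  elim: r v => [|b r IHr] v /=; first by exists [::], [::].
  rewrite {1}/next_layer /=; case: (boolP ((v, b) \in Q)) => vb /= le2.
    by exists [::], (b :: r); rewrite /= vb suffix.
  have [r1 [r2 [-> N1 Q2]]] := IHr _ le2.
  by exists (b :: r1), r2; rewrite /= vb N1.
elim: q u => [|b q IHq] u /=; first by exists [::], [::], [::].
rewrite {1}/next_layer /=; case: (boolP ((u, b) \in Q)) => ub /= le2.
  have [q1 [q2 [q3 [-> Q1 N2 Q3]]]] := IHq _ le2.
  by exists (b :: q1), q2, q3; rewrite /= ub Q1.
have [r1 [r2 [-> N1 Q2]]] := middle _ _ le2.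
by exists [::], (b :: r1), r2; rewrite /= ub N1.
Qed.

(** By [walk_in_simple_path], the path [P :\: Q] is a contiguous segment of [P], so only the edges
    before and after it lie in [Q]. Conversely, the middle block of such a word is [P :\: Q]. *)
Lemma one_disjointP P : one_disjoint E s t Q P <->
  exists q, [/\ all (mem E) (pairmap pair s q), last s q = t, uniq (s :: q),
    (final_layer 0 (pairmap pair s q) <= 2)%N & P = [set e in pairmap pair s q]%SET].
Proof.
split=> [[[q [Pq Lq Uq ->]] [u [v [d [Pd Ld Ud Ed]]]]]|[q [Pq Lq Uq le2 ->]]].
  exists q; split=> //; first by rewrite -path_pairmap.
  have memd e : (e \in pairmap pair u d) = (e \notin Q) && (e \in pairmap pair s q).
    by move/setP/(_ e): Ed; rewrite !inE => <-.
  case: d => [|b d] in Ed Pd Ld Ud memd.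
    rewrite final_layer_even //; apply/allP => e eq /=; apply: contraT => eQ.
    by have := memd e; rewrite eq eQ.
  have [||q1 [q2 E']] := @walk_in_simple_path _ s q u (b :: d) Uq.
  - have /pairmap_pair_split[q1 [q2 ->]] : (u, b) \in pairmap pair s q.
      by have := memd (u, b); rewrite mem_head => /esym/andP[].
    by rewrite mem_cat mem_head orbT.
  - by rewrite path_pairmap; apply/allP => e; rewrite memd => /andP[].
  have Up := pairmap_pair_uniq Uq.
  have [w1 [w3 Ew]] : exists w1 w3,
      pairmap pair s q = w1 ++ pairmap pair u (b :: d) ++ w3.
    case: q1 => [|c q1] in E'.
      case: E' => -> -> /=; rewrite pairmap_cat.
      by exists [::], (pairmap pair (last b d) q2).
    case: E' => _ ->; exists (rcons (pairmap pair s q1) (last s q1, u)).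
    exists (pairmap pair (last b d) q2).
    by rewrite pairmap_cat /= pairmap_cat cat_rcons.
  move: Up memd; rewrite Ew.
  set w2 := pairmap pair u (b :: d) => Up memd.
  (* Edges of a simple path are distinct, so the outer blocks avoid the middle one, which holds
     every edge off [Q]. *)
  move: Up; rewrite cat_uniq cat_uniq has_cat negb_or.
  move=> /and3P[_ /andP[/hasPn d12 _] /and3P[_ /hasPn d23 _]].
  apply: final_layer_three; apply/allP => e ew /=.
  - apply: contraT => eQ; have := memd e; rewrite mem_cat ew eQ /= => /d12.
    by rewrite /= ew.
  - by have := memd e; rewrite ew => /esym/andP[].
  - apply: contraT => eQ; have := memd e; rewrite !mem_cat ew eQ !orbT /=.
    by move=> /(negP (d23 _ ew)).
split; first by exists q; rewrite path_pairmap.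
have [q1 [q2 [q3 [Eq Q1 N2 Q3]]]] := final_layer_le2 le2.
exists (last s q1), (last (last s q1) q2), q2; split=> //.
- by move: Pq; rewrite Eq !pairmap_cat !all_cat path_pairmap => /and3P[].
- move: Uq; rewrite Eq catA -cat_cons cat_uniq => /and3P[+ _ _].
  by rewrite -cat_cons lastI cat_rcons cat_uniq => /and3P[].
apply/setP => e; rewrite !inE Eq !pairmap_cat !mem_cat.
have [e2|e2] := boolP (e \in pairmap pair (last s q1) q2).
  by rewrite orbT andbT; exact: (allP N2).
apply/negP => /andP[eQ /orP[/(allP Q1)|/(allP Q3)]] /=; exact/negP.
Qed.

(* Putting every visit of [t] into layer 2 gives all lifts the same target;
   a simple path does not continue after [t], so no information is lost. *)
Definition lift_step (x : V * 'I_3) (b : V) : V * 'I_3 :=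
  (b, inord (if b == t then 2 else next_layer x.2 (x.1, b))%N).

(** The bound is put on the actual switch count, since the stored layer is set to 2 at [t] and would
    hide a third switch. *)
Definition layered_edges : {set (V * 'I_3) * (V * 'I_3)} :=
  [set e : (V * 'I_3) * (V * 'I_3) | [&& edge_map fst e \in E,
    (next_layer e.1.2 (edge_map fst e) <= 2)%N
    & e.2 == lift_step e.1 e.2.1]]%SET.

(** For [s = t] the source has to be the target, so that the empty path lifts. *)
Definition layered_source : V * 'I_3 :=
  (s, inord (if s == t then 2 else 0)%N).

Definition layered_target : V * 'I_3 := (t, inord 2).

Lemma map_edge_pairmap x (r : seq (V * 'I_3)) :
  map (edge_map fst) (pairmap pair x r) = pairmap pair x.1 (map fst r).
Proof. by elim: r x => //= y r IHr x; rewrite IHr. Qed.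

Lemma imset_edge_pairmap x (r : seq (V * 'I_3)) :
  (edge_map fst @: [set e in pairmap pair x r] =
   [set e in pairmap pair x.1 (map fst r)])%SET.
Proof.
apply/setP => e; rewrite inE -map_edge_pairmap; apply/imsetP/mapP => -[f fr ->].
  by exists f => //; move: fr; rewrite inE.
by exists f => //; rewrite inE.
Qed.

(** The head of a layered edge is a function of its tail and its projected head; this makes lifts
    unique. *)
Lemma layered_path_lift x r :
  path (fun a b => (a, b) \in layered_edges) x r ->
  r = scanl lift_step x (map fst r).
Proof.
elim: r x => //= y r IHr x /andP[]; rewrite inE => /and3P[_ _ /eqP /= <-].
by move=> /IHr <-.
Qed.

Lemma map_fst_lift x q : map fst (scanl lift_step x q) = q.
Proof. by elim: q x => //= b q IHq x; rewrite IHq. Qed.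

Lemma lift_path x q : all (mem E) (pairmap pair x.1 q) -> uniq (x.1 :: q) ->
  last x.1 q = t -> (final_layer x.2 (pairmap pair x.1 q) <= 2)%N ->
  path (fun a b => (a, b) \in layered_edges) x (scanl lift_step x q).
Proof.
elim: q x => //= b q IHq x /andP[xb Pq] /and3P[_ bq Uq] Lq le2.
have le2' := leq_trans (final_layer_ge _ _) le2.
rewrite inE /= /edge_map /= eqxx xb le2' /=.
case: q => [|c q] in IHq Pq bq Uq Lq le2 *; first by [].
apply: IHq => //=; first by rewrite bq.
(* A simple path reaches [t] only at its end, so here the stored layer is the true count. *)
case: eqP => [bt|_]; first by move: bq; rewrite bt -Lq /= mem_last.
by rewrite inordK.
Qed.

Lemma last_lift x b q : last b q = t ->
  last x (scanl lift_step x (b :: q)) = layered_target.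
Proof.
elim: q b x => [|c q IHq] b x /=; last exact: IHq.
by move=> ->; rewrite /lift_step eqxx.
Qed.

Lemma layered_path_final x r :
  path (fun a b => (a, b) \in layered_edges) x r -> uniq (x :: r) ->
  last x r = layered_target ->
  (final_layer x.2 (pairmap pair x.1 (map fst r)) <= 2)%N.
Proof.
elim: r x => [|y r IHr] x /=; first by rewrite -ltnS.
move=> /andP[]; rewrite inE => /and3P[/= _ le2 /eqP Ey] Pr /and3P[_ yr Ur] Lr.
have := IHr y Pr; rewrite cons_uniq yr Ur => /(_ isT Lr).
move: Ey; rewrite /lift_step; case: eqP => [yt|_] Ey; last first.
  by rewrite {1}Ey /= inordK.
(* A step into [t] lands on the target itself, which a simple path meets only at its end. *)
case: r => [//|z r] in IHr Pr yr Ur Lr *.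
by move: yr; rewrite Ey yt -/layered_target -Lr /= mem_last.
Qed.

Lemma layered_path_edges x r :
  path (fun a b => (a, b) \in layered_edges) x r ->
  all (mem E) (pairmap pair x.1 (map fst r)).
Proof.
elim: r x => //= y r IHr x /andP[]; rewrite inE => /and3P[/= xy _ _] /IHr ->.
by rewrite andbT.
Qed.

Lemma layered_path_proj r q :
  path (fun a b => (a, b) \in layered_edges) layered_source r ->
  last layered_source r = layered_target -> uniq (s :: q) -> last s q = t ->
  (edge_map fst @: [set e in pairmap pair layered_source r] =
   [set e in pairmap pair s q])%SET -> map fst r = q.
Proof.
move=> Pr Lr Uq Lq; rewrite imset_edge_pairmap => Er.
apply: walk_in_simple_path_eq Uq _ _.
  rewrite path_pairmap; apply/allP => e er.
  by move/setP/(_ e): Er; rewrite !inE er => /esym.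
by rewrite Lq -[s]/(fst layered_source) last_map Lr.
Qed.

(** The projected walk is the simple path [P] itself, so no two edges of [R] are copies of the same
    edge. *)
Lemma layered_path_sum (M : nmodType) (F : V * V -> M) R P :
  simple_path layered_edges layered_source layered_target R ->
  simple_path E s t P -> (edge_map fst @: R)%SET = P ->
  \sum_(e in R) F (edge_map fst e) = \sum_(e in P) F e.
Proof.
move=> [r [Pr Lr Ur ->]] [q [Pq Lq Uq ->]] Er.
have sum_set (W : finType) (u : W) l (G : W * W -> M) : uniq (u :: l) ->
    \sum_(e in [set e in pairmap pair u l]%SET) G e =
    \sum_(e <- pairmap pair u l) G e.
  move=> Ul; rewrite (big_uniq _ (pairmap_pair_uniq Ul)).
  by apply: eq_bigl => e; rewrite inE.
rewrite !sum_set // -(layered_path_proj Pr Lr Uq Lq Er).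
by rewrite -[s]/(fst layered_source) -map_edge_pairmap big_map.
Qed.

Lemma layered_represents :
  represents_one_disjoint E s t Q layered_edges layered_source layered_target fst.
Proof.
split=> [//|e||R].
- by rewrite inE => /and3P[].
- move=> P /one_disjointP[q [Eq Lq Uq le2 ->]].
  have qnil : s = t -> q = [::].
    case: {Eq le2} q Uq Lq => // b q /andP[sq _] /= Lq st.
    by move: sq; rewrite st -Lq mem_last.
  pose r := scanl lift_step layered_source q.
  have Mr : map fst r = q by exact: map_fst_lift.
  exists [set e in pairmap pair layered_source r]%SET; split.
    split; last by rewrite imset_edge_pairmap Mr.
    exists r; split=> //.
    + apply: lift_path => //=; rewrite inordK; last by case: ifP.
      by case: eqP => // /qnil ->.
    + rewrite /r; case: (q) qnil Lq => [_ st|b q' _ Lq]; last exact: last_lift.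
      by rewrite /layered_source /layered_target; move: st => /= ->; rewrite eqxx.
    + by apply: (@map_uniq _ _ fst); rewrite /= Mr.
  move=> R [[r' [Pr' Lr' Ur' ->]] Er'].
  by rewrite (layered_path_lift Pr') (layered_path_proj _ _ Uq _ Er').
- move=> [r [Pr Lr Ur ->]]; rewrite imset_edge_pairmap.
  have [q [Uq Lq Sq]] := remove_loops s (map fst r).
  exists [set e in pairmap pair s q]%SET; last first.
    by apply/fintype.subsetP => e; rewrite !inE; apply: (mem_subseq Sq).
  apply/one_disjointP; exists q; split=> //.
  + apply/allP => e /(mem_subseq Sq); exact/allP/(layered_path_edges Pr).
  + by rewrite Lq -[s]/(fst layered_source) last_map Lr.
  + apply: leq_trans (final_layer_subseq _ Sq) _.
    (* The source layer is 0, or 2 if [s = t]; monotonicity in the starting layer handles both. *)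
    apply: leq_trans (layered_path_final Pr Ur Lr).
    exact: final_layer_mono.
Qed.

Lemma layered_size :
  (#|{: V * 'I_3}| + #|layered_edges| <= 3 * (#|V| + #|E|))%N.
Proof.
rewrite card_prod card_ord mulnDr mulnC leq_add2l mulnC.
(* An edge is determined by its projection and the layer of its tail, so there are at most three
   copies of each. *)
pose g (e : (V * 'I_3) * (V * 'I_3)) := (edge_map fst e, e.1.2).
have gI : {in layered_edges &, injective g}.
  move=> [[a i] y] [[a' i'] y']; rewrite !inE /g /edge_map /= => /and3P[_ _ /eqP Ey].
  move=> /and3P[_ _ /eqP Ey'] [aa yy ii]; subst a' i'.
  by rewrite Ey Ey' yy.
rewrite -(card_in_imset gI) -[X in (_ * X)%N](card_ord 3) -cardsT -cardsX.
apply: subset_leq_card; apply/fintype.subsetP => _ /imsetP[e + ->].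
by rewrite !inE => /and3P[-> _ _].
Qed.

End LayeredGraph.
(** * Derivatives on [0, d] *)

Section Derivatives.
Variable d : rat.
Hypothesis d_gt0 : 0 < d.
Implicit Types (f g : rat -> rat) (x : rat).

(** Makes limits of difference quotients unique, also at the endpoints. *)
Lemma within_itv_proper x : demand_itv d x ->
  ProperFilter (within (demand_itv d) (dnbhs (x : rat^o))).
Proof.
rewrite /demand_itv /= in_itv /= => /andP[x0 xd]; split; last exact: within_filter.
move=> /nbhs_ballP[e /= e0 /(_ _)] H.
(* This step is shorter than the radius [e] and at most half the interval, so moving towards the
   farther endpoint stays inside. *)
pose m := Num.min e d / 2.
have m0 : 0 < m by rewrite divr_gt0 // lt_min e0.
have me : m < e by rewrite ltr_pdivrMr // mulr_natr mulr2n -[ltLHS]addr0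
    ler_ltD // ge_min lexx.
have md : m <= d / 2 by rewrite ler_pM2r ?invr_gt0 // ge_min lexx orbT.
have [xm|xm] := leP x (d / 2).
  apply: (H (x + m)).
  - by rewrite /ball /= opprD addrA subrr sub0r normrN gtr0_norm.
  - by rewrite -subr_eq0 addrAC subrr add0r gt_eqF.
  - rewrite /= in_itv /= addr_ge0 ?(ltW m0) //=.
    by rewrite (le_trans (lerD xm md)) // -splitr.
apply: (H (x - m)).
- by rewrite /ball /= opprB addrC subrK gtr0_norm.
- by rewrite -subr_eq0 addrAC subrr sub0r oppr_eq0 gt_eqF.
- rewrite /= in_itv /= subr_ge0 (le_trans md (ltW xm)) /=.
  by rewrite (le_trans _ xd) // gerBl ltW.
Qed.

Lemma derive_on_cvg f x : derivable_on (demand_itv d) f -> demand_itv d x ->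
  (diff_quotient f x @ within (demand_itv d) (dnbhs (x : rat^o)) -->
   (derive_on (demand_itv d) f x : rat^o))%classic.
Proof. by move=> df /df. Qed.

Lemma derive_on_sum (I : finType) (A : {set I}) (f : I -> rat -> rat) x :
  (forall i, i \in A -> derivable_on (demand_itv d) (f i)) -> demand_itv d x ->
  derive_on (demand_itv d) (fun y => \sum_(i in A) f i y) x =
  \sum_(i in A) derive_on (demand_itv d) (f i) x.
Proof.
move=> df dx; have PF := within_itv_proper dx.
apply: (@cvg_lim rat^o); first exact: norm_hausdorff.
have -> : diff_quotient (fun y => \sum_(i in A) f i y) x =
    (fun y => \sum_(i in A) (diff_quotient (f i) x y : rat^o)).
  by apply/funext => y; rewrite /diff_quotient -sumrB mulr_suml.
apply: (@cvg_big rat^o _ _ _ _ (@add_continuous rat^o)) => i iA.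
exact: derive_on_cvg (df i iA) dx.
Qed.

Lemma derive_on_ge0 f x :
  (forall y z, 0 <= y -> y <= z -> f y <= f z) ->
  derivable_on (demand_itv d) f -> demand_itv d x ->
  0 <= derive_on (demand_itv d) f x.
Proof.
move=> f_nd df dx; have PF := within_itv_proper dx.
apply: (limr_ge (df x dx)); apply/nbhs_ballP; exists 1 => //= y _ _.
move: dx; rewrite /demand_itv /= !in_itv /= => /andP[x0 _] /andP[y0 _].
rewrite /diff_quotient; have [xy|/ltW yx] := leP x y.
  by rewrite divr_ge0 // subr_ge0 // f_nd.
by rewrite -mulrNN -invrN !opprB divr_ge0 // subr_ge0 // f_nd.
Qed.

Lemma derivable_on_subset (D1 D2 : set rat) f : (D1 `<=` D2)%classic ->
  derivable_on D2 f -> derivable_on D1 f.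
Proof.
move=> D12 df x D1x; have dfx := df x (D12 _ D1x).
apply: (cvgP (derive_on D2 f x : rat^o)).
apply: cvg_trans dfx.
by apply: cvg_app; apply: (@within_subset rat^o _ _ _ _ D12).
Qed.

End Derivatives.

(** * Weights *)

Section ParetoRepresentation.
Variables (d : rat) (T : set (rat -> rat)) (k : nat).
Variable p : (rat -> rat) -> 'rV[rat]_k.
Hypothesis p_repr : pareto_representation d T p.
Implicit Types f g : rat -> rat.

Lemma pareto_representation_sum (I : finType) (A : {set I}) (f : I -> rat -> rat) :
  A != finset.set0 -> (forall i, i \in A -> T (f i)) ->
  T (fun x => \sum_(i in A) f i x) /\
  p (fun x => \sum_(i in A) f i x) = \sum_(i in A) p (f i).
Proof.
have [TD _ pD] := p_repr.
(* The induction starts at a single summand, as closure under addition does not provide the zero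
   function. *)
have sum_seq i r : (forall j, j \in i :: r -> T (f j)) ->
    T (fun x => \sum_(j <- i :: r) f j x) /\
    p (fun x => \sum_(j <- i :: r) f j x) = \sum_(j <- i :: r) p (f j).
  elim: r i => [|j r IHr] i Tf.
    have -> : (fun x => \sum_(j <- [:: i]) f j x) = f i.
      by apply/funext => x; rewrite big_seq1.
    by rewrite big_seq1; split => //; apply: Tf; rewrite mem_head.
  have -> : (fun x => \sum_(l <- i :: j :: r) f l x) =
      (fun x => f i x + \sum_(l <- j :: r) f l x).
    by apply/funext => x; rewrite big_cons.
  have Ti : T (f i) by apply: Tf; rewrite mem_head.
  have [l lr|Tr pr] := IHr j; first by apply: Tf; rewrite inE lr orbT.
  by rewrite big_cons -pr; split; [apply: TD|apply: pD].
move=> A0 Tf; have -> : (fun x => \sum_(i in A) f i x) =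
    (fun x => \sum_(i <- enum A) f i x).
  by apply/funext => x; rewrite big_enum.
rewrite -big_enum.
case eA: (enum A) => [|i r].
  by case/set0Pn: A0 => i; rewrite -mem_enum eA.
by apply: sum_seq => j; rewrite -eA mem_enum; apply: Tf.
Qed.

(** Comparing [f] with [f + f], additivity turns the order condition into a sign condition on
    [p f]. *)
Lemma pareto_representation_ge0 f i : T f ->
  (forall x, 0 <= x <= d -> 0 <= f x) -> 0 <= p f 0 i.
Proof.
move=> Tf f0; have [TD ple pD] := p_repr.
have /ple : le_on d f (fun x => f x + f x) by move=> x /f0 fx; rewrite lerDl.
by move=> /(_ Tf (TD _ _ Tf Tf) i); rewrite pD // mxE lerDl.
Qed.

(** The same comparison backwards: a nonpositive [p f] forces [f + f <= f]. *)
Lemma pareto_representation_le0 f x : T f -> (forall i, p f 0 i <= 0) ->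
  0 <= x <= d -> f x <= 0.
Proof.
move=> Tf pf0 xd; have [TD ple pD] := p_repr.
have /ple /(_ x xd) : forall i, p (fun x => f x + f x) 0 i <= p f 0 i.
  by move=> i; rewrite pD // mxE gerDl.
by rewrite gerDl; apply => //; apply: TD.
Qed.

(* Empty sums are treated apart: the zero function need not belong to [T]. *)
Lemma pareto_representation_sum_le (I : finType) (A B : {set I})
    (f : I -> rat -> rat) :
  (forall i, i \in (A :|: B)%SET -> T (f i)) ->
  (forall i x, i \in (A :|: B)%SET -> 0 <= x <= d -> 0 <= f i x) ->
  (forall j, (\sum_(i in A) p (f i)) 0 j <= (\sum_(i in B) p (f i)) 0 j) ->
  le_on d (fun x => \sum_(i in A) f i x) (fun x => \sum_(i in B) f i x).
Proof.
move=> Tf f0 leAB x xd; have [_ ple _] := p_repr.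
have B0 : 0 <= \sum_(i in B) f i x.
  by apply: sumr_ge0 => i iB; apply: f0; rewrite // inE iB orbT.
have [->|An] := eqVneq A finset.set0; first by rewrite big_set0.
have [TA pA] : _ /\ _ := pareto_representation_sum An
  (fun i iA => Tf i (fintype.subsetP (finset.subsetUl A B) i iA)).
have [BE|Bn] := eqVneq B finset.set0.
  apply: le_trans B0; apply: (pareto_representation_le0 TA) xd => i.
  by rewrite pA (le_trans (leAB i)) // BE big_set0 mxE.
have [TB pB] : _ /\ _ := pareto_representation_sum Bn
  (fun i iB => Tf i (fintype.subsetP (finset.subsetUr A B) i iB)).
have /ple : forall j, p (fun x => \sum_(i in A) f i x) 0 j <=
    p (fun x => \sum_(i in B) f i x) 0 j.
  by move=> j; rewrite pA pB.
by apply.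
Qed.

End ParetoRepresentation.

(** Grouped by image, each group over [B] contains at least one copy of [G j], and all surplus terms
    are nonnegative. *)
Lemma sum_imset_ge (R : numDomainType) (I J : finType) (h : I -> J)
    (A : {set I}) (B : {set J}) (G : J -> R) :
  (forall j, j \in (h @: A)%SET -> 0 <= G j) -> B \subset (h @: A)%SET ->
  \sum_(j in B) G j <= \sum_(i in A) G (h i).
Proof.
move=> G0 BA; rewrite (partition_big_imset h) (big_setID B) /=.
have -> : (h @: A :&: B)%SET = B by apply/finset.setIidPr.
rewrite -[leLHS]addr0; apply: lerD; last first.
  apply: sumr_ge0 => j; rewrite inE => /andP[_ jA].
  by apply: sumr_ge0 => i /andP[_ /eqP->]; apply: G0.
apply: ler_sum => j /(fintype.subsetP BA) /[dup] jA /imsetP[i iA ji].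
rewrite (bigD1 i) ?iA ?ji //= lerDl.
by apply: sumr_ge0 => i' /andP[/andP[_ /eqP->] _]; rewrite G0 // -ji.
Qed.

Lemma exists_argmin (I : finType) (P : pred I) (F : I -> rat) i0 : P i0 ->
  exists2 i, P i & forall j, P j -> F i <= F j.
Proof.
by move=> Pi0; case: (Order.TotalTheory.arg_minP F Pi0) => i Pi Fi; exists i.
Qed.

(** * Edge weights and domination between alternatives *)

Section EdgeWeights.
Variables (V : finType) (E Q : {set V * V}).
Variables (d : rat) (tau : V * V -> rat -> rat) (k l : nat).
Variable T : set (rat -> rat).
Variable p : (rat -> rat) -> 'rV[rat]_k.
Variable p' : (rat -> rat) -> 'rV[rat]_l.
Hypothesis d_gt0 : 0 < d.
Hypothesis tau_cost : forall e, e \in E -> cost_function (tau e).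
Hypothesis tau_T : forall e, e \in E -> T (tau e).
Hypothesis p_repr : pareto_representation d T p.
Hypothesis p'_repr : pareto_representation d (derivative_class d T) p'.
Implicit Types (e : V * V) (P : {set V * V}).

Let marginal e : rat -> rat := derive_on (demand_itv d) (tau e).

(** [copy_weight] is convertible to this function composed with [edge_map], so weights in the
    layered graph are compared in G. *)
Definition edge_weight e : 'rV[rat]_(k + l) :=
  row_mx (p (tau e)) (if e \in Q then p' (marginal e) else 0).

Lemma tau_derivable e : e \in E -> derivable_on (demand_itv d) (tau e).
Proof.
move=> /tau_cost[_ _]; apply: derivable_on_subset => x.
by rewrite /demand_itv /= !in_itv /= andbT => /andP[].
Qed.

Lemma marginal_ge0 e x : e \in E -> 0 <= x <= d -> 0 <= marginal e x.
Proof.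
move=> eE xd; apply: derive_on_ge0; rewrite /demand_itv /= ?in_itv //=.
  by case: (tau_cost eE).
exact: tau_derivable.
Qed.

Lemma marginal_class e : e \in E -> derivative_class d T (marginal e).
Proof.
by move=> eE; exists (tau e); split=> //; [apply: tau_T|apply: tau_derivable].
Qed.

Lemma tau_ge0 e x : e \in E -> 0 <= x <= d -> 0 <= tau e x.
Proof. by move=> /tau_cost[pos _ _] /andP[/pos/ltW]. Qed.

Lemma edge_weight_ge0 e i : e \in E -> 0 <= edge_weight e 0 i.
Proof.
move=> eE; rewrite mxE; case: splitP => j _.
  apply: (pareto_representation_ge0 p_repr); first exact: tau_T.
  by move=> x; apply: tau_ge0.
case: ifP => _; last by rewrite mxE.
apply: (pareto_representation_ge0 p'_repr); first exact: marginal_class.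
by move=> x; apply: marginal_ge0.
Qed.

(** Otherwise [tau e] would be nonpositive at 0. Hence omitting an edge strictly lowers some
    coordinate of the weight. *)
Lemma edge_weight_not_le0 e : e \in E -> ~ forall i, edge_weight e 0 i <= 0.
Proof.
move=> eE w0; have [pos _ _] := tau_cost eE.
have : tau e 0 <= 0.
  apply: (pareto_representation_le0 p_repr); first exact: tau_T.
    by move=> i; have := w0 (lshift l i); rewrite row_mxEl.
  by rewrite lexx ltW.
by rewrite leNgt pos.
Qed.

(** The last [l] coordinates vanish off [Q], so over a path they represent the summed marginals on
    its part in [Q], which is the derivative that domination compares. *)
Lemma dominates_of_weight P1 P2 : P1 \subset E -> P2 \subset E ->
  (forall i, path_weight edge_weight P1 0 i <= path_weight edge_weight P2 0 i) ->
  dominates d tau Q P1 P2.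
Proof.
move=> /fintype.subsetP P1E /fintype.subsetP P2E le12.
have wE P : path_weight edge_weight P =
    row_mx (\sum_(e in P) p (tau e)) (\sum_(e in P :&: Q) p' (marginal e)).
  apply/rowP => i; rewrite summxE; case: (split_ordP i) => j ->.
    by rewrite row_mxEl summxE; apply: eq_bigr => e _; rewrite row_mxEl.
  rewrite row_mxEr summxE (eq_bigl _ _ (fun e => finset.in_setI e P Q)) big_mkcondr /=.
  by apply: eq_bigr => e _; rewrite row_mxEr; case: ifP; rewrite // mxE.
have inE1 e : e \in (P1 :|: P2)%SET -> e \in E by rewrite inE => /orP[/P1E|/P2E].
have inE2 e : e \in ((P1 :&: Q) :|: (P2 :&: Q))%SET -> e \in E.
  by rewrite -finset.setIUl inE => /andP[/inE1].
split.
  apply: (pareto_representation_sum_le p_repr).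
  - by move=> e /inE1; apply: tau_T.
  - by move=> e x /inE1; apply: tau_ge0.
  - by move=> j; have := le12 (lshift l j); rewrite !wE !row_mxEl.
have derivE P x : P \subset E -> 0 <= x <= d ->
    derive_on (demand_itv d) (path_cost tau (P :&: Q)) x =
    \sum_(e in P :&: Q) marginal e x.
  move=> /fintype.subsetP PE xd; apply: derive_on_sum => //.
  by move=> e; rewrite inE => /andP[/PE/tau_derivable].
have leQ : le_on d (fun x => \sum_(e in P1 :&: Q) marginal e x)
    (fun x => \sum_(e in P2 :&: Q) marginal e x).
  apply: (pareto_representation_sum_le p'_repr).
  - by move=> e /inE2; apply: marginal_class.
  - by move=> e x /inE2; apply: marginal_ge0.
  - by move=> j; have := le12 (rshift k j); rewrite !wE !row_mxEr.
by move=> x xd; rewrite !derivE //; [apply: leQ|apply/fintype.subsetP..].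
Qed.

Lemma path_weight_imset_ge (J : finType) (h : J -> V * V) (A : {set J}) P i :
  (h @: A)%SET \subset E -> P \subset (h @: A)%SET ->
  path_weight edge_weight P 0 i <= (\sum_(e in A) edge_weight (h e)) 0 i.
Proof.
move=> /fintype.subsetP AE PA; rewrite !summxE.
by apply: (sum_imset_ge (G := fun e => edge_weight e 0 i)) PA => e /AE/edge_weight_ge0.
Qed.

End EdgeWeights.

(** * The reduction to Pareto optimal paths of the layered graph *)

Theorem theorem4 :
  exists c : nat,
  forall (V : finType) (E : {set V * V}) (s t : V) (Q : {set V * V})
    (d : rat) (tau : V * V -> rat -> rat)
    (k l : nat) (T : set (rat -> rat))
    (p : (rat -> rat) -> 'rV[rat]_k) (p' : (rat -> rat) -> 'rV[rat]_l)
    (x : {set V * V} -> rat),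
  simple_path E s t Q ->
  0 < d ->
  (forall e, e \in E -> cost_function (tau e)) ->
  (forall P1 P2, simple_path E s t P1 -> simple_path E s t P2 ->
     dominates d tau Q P1 P2 -> dominates d tau Q P2 P1 -> P1 = P2) ->
  (forall e, e \in E -> T (tau e)) ->
  pareto_representation d T p ->
  pareto_representation d (derivative_class d T) p' ->
  (forall P, simple_path E s t P -> 0 <= x P <= d) ->
  pareto_conform E s t d tau Q x ->
  exists (V' : finType) (E' : {set V' * V'}) (s' t' : V') (pi : V' -> V),
    [/\ (#|V'| + #|E'| <= c * (#|V| + #|E|))%N,
        represents_one_disjoint E s t Q E' s' t' pi,
        forall R, pareto_optimal_path E' s' t' (copy_weight d tau Q p p' pi) R ->
          one_disjoint E s t Q (edge_map pi @: R)%SET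
      & exists2 R, pareto_optimal_path E' s' t' (copy_weight d tau Q p p' pi) R
          & optimal_1D_SAP E s t d tau Q x (edge_map pi @: R)%SET].
Proof.
exists 3 => V E s t Q d tau k l T p p' x sQ d0 tau_cost _ tau_T p_repr p'_repr _ xP.
pose w := edge_weight Q d tau p p'.
have rep := layered_represents E Q s t.
exists (V * 'I_3)%type, (layered_edges E Q t), (layered_source s t).
exists (layered_target t), fst.
have [_ E'E lift proj] := rep.
have simple_sub (W : finType) (F : {set W * W}) (u v : W) P :
    simple_path F u v P -> P \subset F.
  move=> [q [+ _ _ ->]]; rewrite path_pairmap => /allP qF.
  by apply/fintype.subsetP => e; rewrite inE => /qF.
have RE R : simple_path (layered_edges E Q t) (layered_source s t)
    (layered_target t) R -> (edge_map fst @: R)%SET \subset E.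
  move=> /simple_sub/fintype.subsetP RE'.
  by apply/fintype.subsetP => _ /imsetP[e /RE'/E'E eE ->].
have liftw P : one_disjoint E s t Q P -> exists R,
    [/\ simple_path (layered_edges E Q t) (layered_source s t) (layered_target t) R,
      (edge_map fst @: R)%SET = P &
      path_weight (copy_weight d tau Q p p' fst) R = path_weight w P].
  move=> /[dup] -[sP _] /lift[R [[sR RP] _]]; exists R; split=> //.
  exact: (layered_path_sum w sR sP RP).
have w_ge R (P : {set V * V}) i : simple_path (layered_edges E Q t) (layered_source s t)
    (layered_target t) R -> P \subset (edge_map fst @: R)%SET ->
    path_weight w P 0 i <= path_weight (copy_weight d tau Q p p' fst) R 0 i.
  move=> sR PR.
  exact: (path_weight_imset_ge Q d0 tau_cost tau_T p_repr p'_repr i (RE _ sR) PR).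
split=> //; first exact: layered_size.
  move=> R [sR Ropt]; have [P dP PR] := proj _ sR.
  suff -> : (edge_map fst @: R)%SET = P by [].
  apply/eqP; rewrite finset.eqEsubset PR andbT; apply/fintype.subsetP => e eR.
  (* If [P] misses [e], the lift of [P] dominates [R]: equal weights would leave no room for [e] and
     make its weight nonpositive. *)
  apply: contraT => eP; have [RP [sRP _ wRP]] := liftw _ dP; case: Ropt.
  exists RP; rewrite wRP; split=> // [i|wE]; first exact: w_ge.
  have eE := fintype.subsetP (RE _ sR) e eR.
  case: (edge_weight_not_le0 (Q := Q) (p' := p') d0 tau_cost tau_T p_repr eE) => i.
  have := @w_ge R (e |: P)%SET i sR; rewrite finset.subUset finset.sub1set eR PR => /(_ isT).
  by rewrite -wE /path_weight big_setU1 //= mxE gerDr.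
have dQ : one_disjoint E s t Q Q.
  by split=> //; exists s, s; rewrite finset.setDv; exists [::].
have [|P0 /asboolP dP0 minP0] := @exists_argmin _
  (fun P => `[< one_disjoint E s t Q P >]) (alternative_cost d tau Q x) Q.
  exact/asboolP.
(* Ties in cost are broken by the sum of all weight coordinates, which strictly drops under Pareto
   domination. *)
pose best (P : {set V * V}) := `[< one_disjoint E s t Q P >] &&
  (alternative_cost d tau Q x P <= alternative_cost d tau Q x P0).
have [|P1 /andP[/asboolP dP1 P10] minP1] := @exists_argmin _ best
  (fun P => \sum_i path_weight w P 0 i) P0.
  by rewrite /best lexx andbT; apply/asboolP.
have [R1 [sR1 R1P wR1]] := liftw _ dP1.
exists R1; last first.
  rewrite R1P; split=> // P' dP'; apply: le_trans P10 _; apply: minP0.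
  exact/asboolP.
split=> // -[R' [sR' leR' neR']]; have [P dP PR] := proj _ sR'.
have leP i : path_weight w P 0 i <= path_weight w P1 0 i.
  by rewrite -wR1; apply: le_trans (leR' i); apply: w_ge.
(* Weight domination of [P1] by [P] and Pareto-conformity keep [P] among the cost minimizers. *)
have bP : best P.
  rewrite /best; apply/andP; split; first exact/asboolP.
  apply: le_trans P10; have [sP _] := dP; have [sP1 _] := dP1.
  apply: xP => //.
  exact: (dominates_of_weight d0 tau_cost tau_T p_repr p'_repr
    (simple_sub _ _ _ _ _ sP) (simple_sub _ _ _ _ _ sP1)).
apply: neR'; apply/rowP => i; apply/eqP; rewrite eq_le leR' /=.
(* A strict inequality in coordinate [i] would give [P] a smaller coordinate sum than [P1]. *)
apply: le_trans (w_ge _ _ i sR' PR); rewrite wR1 leNgt; apply/negP => lti.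
have := minP1 _ bP; rewrite leNgt => /negP; apply.
rewrite (bigD1 i) //= [ltRHS](bigD1 i) //= ltr_leD //.
by apply: ler_sum => j _; apply: leP.
Qed.
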